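(* Let $A\in\mathbb{C}^{p\times p}$, $B\in\mathbb{C}^{p\times q}$, $D\in\mathbb{C}^{q\times q}$, $E\in\mathbb{C}^{p\times q}$, and let $m\ge \mathrm{Ind}(A)$ and $n\ge \mathrm{Ind}(D)$ be integers. Let $(A^{m})^{(1)}$ and $(D^{n})^{(1)}$ be $\{1\}$-inverses of $A^m$ and $D^n$ respectively, and put $$X_{1}=(A^{m})^{(1)}B+E(D^{n})^{(1)}-(A^{m})^{(1)}A^{m}E(D^{n})^{(1)}.$$ If the matrix system $$A^{m}X=B\quad\wedge\quad XD^{n}=E$$ (in the unknown $X\in\mathbb{C}^{p\times q}$) is consistent, then its general solution is given by the formula $$X=f(Y)=X_{1}+(I-(A^{m})^{(1)}A^{m})\,Y\,(I-D^{n}(D^{n})^{(1)}),$$ where $Y\in\mathbb{C}^{p\times q}$ is arbitrary; that is, for every $Y\in\mathbb{C}^{p\times q}$ the matrix $f(Y)$ is a solution of the system, and every solution $X$ is of the form $X=f(Y)$ for some $Y\in\mathbb{C}^{p\times q}$.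
   Context: For a complex matrix $M\in\mathbb{C}^{a\times b}$, a $\{1\}$-inverse of $M$ is any matrix $M^{(1)}\in\mathbb{C}^{b\times a}$ with $MM^{(1)}M=M$; it always exists but in general is not unique. For a square matrix $M$, the index $\mathrm{Ind}(M)$ is the smallest non-negative integer $k$ with $\mathrm{rank}(M^k)=\mathrm{rank}(M^{k+1})$ (with $M^0=I$). $I$ denotes the identity matrix of the appropriate order. A system is consistent if it has at least one solution. A formula $X=\phi(Y)$ represents the general solution of a system if $\phi(Y)$ is a solution for every $Y$, and every solution $X$ equals $\phi(Y)$ for some $Y$. *)

(* Defs.v *)
From mathcomp Require Import all_boot all_order all_algebra.

Set Implicit Arguments.
Unset Strict Implicit.
Unset Printing Implicit Defensive.

Import GRing.Theory.
Local Open Scope ring_scope.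

Definition is_inner_inverse (F : fieldType) (a b : nat)
    (M : 'M[F]_(a, b)) (N : 'M[F]_(b, a)) : Prop :=
  M *m N *m M = M.

Lemma mxindex_subproof (F : fieldType) (p : nat) (M : 'M[F]_p) :
  exists k : nat, \rank (M ^+ k) == \rank (M ^+ k.+1).
Proof.
case: (boolP [exists k : 'I_p.+1, \rank (M ^+ k) == \rank (M ^+ k.+1)]).
  by case/existsP=> k rk; exists k.
rewrite negb_exists => /forallP neq_rk.
have lt_rk k : (k <= p)%N -> (\rank (M ^+ k.+1) < \rank (M ^+ k))%N.
  move=> le_kp; rewrite ltn_neqAle eq_sym (neq_rk (Ordinal (le_kp : k < p.+1)%N)).
  by rewrite exprS; exact: mxrankM_maxr.
have bound k : (k <= p.+1)%N -> (\rank (M ^+ k) + k <= p)%N.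
  elim: k => [|k IHk] le_kp; first by rewrite addn0 rank_leq_row.
  rewrite addnS; apply: leq_trans (IHk (ltnW le_kp)).
  by rewrite ltn_add2r lt_rk.
by have := leq_trans (leq_addl _ _) (bound p.+1 (leqnn _)); rewrite ltnn.
Qed.

(* In this ring structure M ^+ 0 is the identity matrix and multiplication is
   *m, including in the degenerate case p = 0. *)
Definition mxindex (F : fieldType) (p : nat) (M : 'M[F]_p) : nat :=
  ex_minn (mxindex_subproof M).

Definition is_general_solution (T U : Type) (sol : T -> Prop) (phi : U -> T) :
    Prop :=
  (forall Y, sol (phi Y)) /\ (forall X, sol X -> exists Y, X = phi Y).

(* Main.v *)
(* If X0 is any solution of P X = B, X Q = E, and G, H are {1}-inverses of P, Q,
   then f(Y) = X0 + (I - G P) (Y - X0) (I - Q H).  Since P (I - G P) = 0 and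
   (I - Q H) Q = 0, every f(Y) is a solution; and f(X0) = X0, where X0 is an
   arbitrary solution. *)

Require Import Defs.
From mathcomp Require Import all_boot all_order all_algebra.
From mathcomp Require Import complex.
From mathcomp Require Import reals.

Import GRing.Theory.
Local Open Scope ring_scope.
Local Open Scope complex_scope.

(** Expanding (I - G P) X (I - Q H) gives X - G P X - X Q H + G P X Q H, so the terms without Y on
    the left add up to X - (I - G P) X (I - Q H). *)
Lemma inner_inverse_two_sided_shift (F : fieldType) (a p q b : nat)
    (P : 'M[F]_(a, p)) (Q : 'M[F]_(q, b)) (G : 'M[F]_(p, a)) (H : 'M[F]_(b, q))
    (X Y : 'M[F]_(p, q)) :
  G *m (P *m X) + X *m Q *m H - G *m P *m (X *m Q) *m H
    + (1%:M - G *m P) *m Y *m (1%:M - Q *m H)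
  = X + (1%:M - G *m P) *m (Y - X) *m (1%:M - Q *m H).
Proof.
(* The Y-term of the right side is split off and cancelled, leaving the expansion in X alone. *)
rewrite (mulmxBr _ Y X) (mulmxBl (_ *m Y)) [RHS]addrA [RHS]addrAC; congr (_ + _).
rewrite !(mulmxBl, mulmxBr) !mulmx1 !mul1mx !mulmxA.
by rewrite !opprB [RHS]addrCA (addrCA X) subrr addr0 -addrA addrC.
Qed.

Lemma inner_inverse_general_solution (F : fieldType) (a p q b : nat)
    (P : 'M[F]_(a, p)) (Q : 'M[F]_(q, b)) (G : 'M[F]_(p, a)) (H : 'M[F]_(b, q))
    (B : 'M[F]_(a, q)) (E : 'M[F]_(p, b)) :
  is_inner_inverse P G -> is_inner_inverse Q H ->
  (exists X, P *m X = B /\ X *m Q = E) ->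
  is_general_solution (fun X => P *m X = B /\ X *m Q = E) (fun Y =>
    G *m B + E *m H - G *m P *m E *m H
      + (1%:M - G *m P) *m Y *m (1%:M - Q *m H)).
Proof.
(* Consistency is used to write [B] as P X0 and [E] as X0 Q, the form the shift identity expects. *)
move=> PGP QHQ [X0 [<- <-]].
have annP : P *m (1%:M - G *m P) = 0 by rewrite mulmxBr mulmx1 mulmxA PGP subrr.
have annQ : (1%:M - Q *m H) *m Q = 0 by rewrite mulmxBl mul1mx QHQ subrr.
split=> [Y | X [PX XQ]].
  rewrite inner_inverse_two_sided_shift; split.
    by rewrite (mulmxDr P) !mulmxA annP !mul0mx addr0.
  by rewrite (mulmxDl X0) -[_ *m _ *m Q]mulmxA annQ mulmx0 addr0.
(* Since P X0 = P X and X0 Q = X Q, the base point moves from [X0] to [X]; with Y = X the correction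
   term contains X - X. *)
exists X; rewrite -PX -XQ inner_inverse_two_sided_shift.
by rewrite subrr mulmx0 mul0mx addr0.
Qed.

Theorem theorem2p3 (R : realType) (p q : nat)
    (A : 'M[R[i]]_p) (B : 'M[R[i]]_(p, q)) (D : 'M[R[i]]_q)
    (E : 'M[R[i]]_(p, q)) (m n : nat)
    (hm : (mxindex A <= m)%N) (hn : (mxindex D <= n)%N)
    (Am1 : 'M[R[i]]_p) (Dn1 : 'M[R[i]]_q)
    (hAm1 : is_inner_inverse (A ^+ m) Am1)
    (hDn1 : is_inner_inverse (D ^+ n) Dn1) :
  let sol (X : 'M[R[i]]_(p, q)) := A ^+ m *m X = B /\ X *m D ^+ n = E in
  let X1 := Am1 *m B + E *m Dn1 - Am1 *m A ^+ m *m E *m Dn1 in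
  let f (Y : 'M[R[i]]_(p, q)) :=
    X1 + (1%:M - Am1 *m A ^+ m) *m Y *m (1%:M - D ^+ n *m Dn1) in
  (exists X, sol X) -> is_general_solution sol f.
Proof. by move=> sol X1 f; apply: inner_inverse_general_solution. Qed.
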